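(* Suppose that $\Xi=\{0,1\}^{m_1}\times\{\xi_T\}$ for a fixed $\xi_T\in\mathbb{R}^{m_2}$. For $j\in[N]$ let $\mathcal C_0(\zeta_q^j)=\{t\in[m_1]:\zeta_{qt}^j=0\}$ and $\mathcal C_1(\zeta_q^j)=\{t\in[m_1]:\zeta_{qt}^j=1\}$, and suppose that the polyhedron $$\left\{(\pi,\xi_q)\in\mathbb{R}_+^\ell\times[0,1]^{m_1}:\ W^\top\pi=Q\xi_q+q,\ \sum_{t\in\mathcal C_0(\zeta_q^j)}\xi_{qt}+\sum_{t\in\mathcal C_1(\zeta_q^j)}(1-\xi_{qt})\le\kappa\right\}$$ is integral for all $j\in[N]$ and all nonnegative integers $\kappa$. Then for any $p\in[1,\infty)$ and every $x\in\mathcal X$, $$\mathcal Z(x)=\frac1N\sum_{j\in[N]}\ \min_{y\in\mathbb{R}^{n_2},\,\lambda\in\mathbb{R}_+,\,\sigma\in\mathbb{R}_+^{m_1}}\Big\{(Q\zeta_q^j+q)^\top y+\lfloor\theta^p\rfloor\lambda+\sum_{t\in[m_1]}\sigma_t\Big\}$$ where, for each $j$, the minimum is subject to $$T(x)\xi_T+Wy\ge h(x),\qquad \lambda+\sigma_t\ge(Q^\top y)_t\ \ \forall t\in\mathcal C_0(\zeta_q^j),\qquad \lambda+\sigma_t\ge-(Q^\top y)_t\ \ \forall t\in\mathcal C_1(\zeta_q^j).$$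
   Context: Setting. $[k]=\{1,\dots,k\}$. Let $n_1,n_2,m_1,m_2,\ell,N$ be positive integers, $\mathcal X\subseteq\mathbb{R}^{n_1}$, $c\in\mathbb{R}^{n_1}$, $W\in\mathbb{R}^{\ell\times n_2}$, $Q\in\mathbb{R}^{n_2\times m_1}$, $q\in\mathbb{R}^{n_2}$ fixed, and let $h:\mathbb{R}^{n_1}\to\mathbb{R}^{\ell}$ and $T:\mathbb{R}^{n_1}\to\mathbb{R}^{\ell\times m_2}$ be affine. The support is $\Xi=\Xi_q\times\Xi_T$ with $\Xi_q\subseteq\mathbb{R}^{m_1}$, $\Xi_T\subseteq\mathbb{R}^{m_2}$. For $\xi=(\xi_q,\xi_T)\in\Xi$ the recourse function is $$Z(x,\xi)=\min_{y\in\mathbb{R}^{n_2}}\{(Q\xi_q+q)^\top y:\ T(x)\xi_T+Wy\ge h(x)\}.$$ Minima are read as infima, equal to $+\infty$ if infeasible. Ambiguity set. Given $p\in[1,\infty]$, $\theta\ge0$ and points $\zeta^j=(\zeta_q^j,\zeta_T^j)\in\Xi$, $j\in[N]$, let $\mathbb{P}_{\tilde\zeta}$ be the empirical distribution putting mass $1/N$ on each $\zeta^j$. Let $W^\infty(\mathbb{P}_1,\mathbb{P}_2)$ be the infimum, over all joint distributions $\mathbb{Q}$ of $(\tilde\xi_1,\tilde\xi_2)$ with marginals $\mathbb{P}_1,\mathbb{P}_2$, of the $\mathbb{Q}$-essential supremum of $\|\tilde\xi_1-\tilde\xi_2\|_p$, where $\|\cdot\|_p$ is the $\ell_p$ norm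 on $\mathbb{R}^{m_1+m_2}$. Let $\mathcal P=\{\mathbb{P}:\mathbb{P}(\tilde\xi\in\Xi)=1,\ W^\infty(\mathbb{P},\mathbb{P}_{\tilde\zeta})\le\theta\}$ and $\mathcal Z(x)=\sup_{\mathbb{P}\in\mathcal P}\mathbb{E}_{\mathbb{P}}[Z(x,\tilde\xi)]$. Standing assumption (sufficiently expensive recourse). For all $x\in\mathcal X$ and $\xi\in\Xi$ the dual of the recourse problem is feasible, i.e. there is $\pi\in\mathbb{R}_+^\ell$ with $W^\top\pi=Q\xi_q+q$. Integrality. A rational polyhedron $P\subseteq\mathbb{R}^n$ is integral if $P=\operatorname{conv}(P\cap\mathbb{Z}^n)$. *)

(* Defs.v *)
From HB Require Import structures.
From mathcomp Require Import all_boot all_order all_algebra.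
From mathcomp Require Import all_classical all_reals all_analysis.
From mathcomp Require Import ess_sup_inf.

Set Implicit Arguments.
Unset Strict Implicit.
Unset Printing Implicit Defensive.

Import Order.TTheory GRing.Theory Num.Theory.
Import numFieldNormedType.Exports.

Local Open Scope classical_set_scope.
Local Open Scope ring_scope.

(* Matrices, in particular column vectors, carry the Borel sigma-algebra. *)
HB.instance Definition _ (R : realType) (m n : nat) :=
  Measurable.copy 'M[R]_(m, n) (g_sigma_algebraType (@open 'M[R]_(m, n))).

Definition dotv (R : realType) (n : nat) (u v : 'cV[R]_n) : R :=
  (u^T *m v) 0 0.

Definition is_affine (R : realType) (U V : lmodType R) (f : U -> V) : Prop :=
  exists (L : {linear U -> V}) (b : V), forall x, f x = L x + b.

(* Intended for finite exponents p >= 1. *)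
Definition lp_norm (R : realType) (n : nat) (p : R) (v : 'cV[R]_n) : R :=
  (\sum_(i < n) `|v i 0| `^ p) `^ p^-1.

Section Recourse.
Context (R : realType) (n1 n2 m1 m2 l : nat).
Variables (W : 'M[R]_(l, n2)) (Q : 'M[R]_(n2, m1)) (q : 'cV[R]_n2).
Variables (h : 'cV[R]_n1 -> 'cV[R]_l) (T : 'cV[R]_n1 -> 'M[R]_(l, m2)).

Definition recourse_feasible (x : 'cV[R]_n1) (xiT : 'cV[R]_m2) :
    set 'cV[R]_n2 :=
  [set y | forall i, h x i 0 <= (T x *m xiT + W *m y) i 0].

Definition recourse (x : 'cV[R]_n1) (xi : 'cV[R]_m1 * 'cV[R]_m2) : \bar R :=
  ereal_inf [set (dotv (Q *m xi.1 + q) y)%:E | y in recourse_feasible x xi.2].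

Definition expensive_recourse (X : set 'cV[R]_n1)
    (Xi : set ('cV[R]_m1 * 'cV[R]_m2)) : Prop :=
  forall x xi, X x -> Xi xi ->
    exists pi : 'cV[R]_l,
      (forall i, 0 <= pi i 0) /\ W^T *m pi = Q *m xi.1 + q.

End Recourse.

Section Empirical.
Local Open Scope ereal_scope.
Context d (U : measurableType d) (R : realType) (N : nat).
Variable zeta : 'I_N -> U.

Definition empirical (A : set U) : \bar R :=
  (N%:R^-1)%:E * \sum_(j < N) \d_(zeta j) A.

Let empirical0 : empirical set0 = 0.
Proof. by rewrite /empirical big1 ?mule0 // => j _; rewrite measure0. Qed.

Let empirical_ge0 A : 0 <= empirical A.
Proof.
by apply: mule_ge0; [rewrite lee_fin invr_ge0 | apply: sume_ge0 => j _].
Qed.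

Let empirical_sigma_additive : semi_sigma_additive empirical.
Proof.
case: (posnP N) => [N0|N_gt0].
  have -> : empirical = (@mzero _ U R : set U -> \bar R).
    apply/funext => A; rewrite /empirical big1 ?mule0 // => j _.
    by have := ltn_ord j; rewrite [X in (_ < X)%N]N0 ltn0.
  exact: measure_semi_sigma_additive.
pose m (k : nat) : {measure set U -> \bar R} :=
  \d_(zeta (insubd (Ordinal N_gt0) k)).
have c_ge0 : (0 <= (N%:R : R)^-1)%R by rewrite invr_ge0.
pose c : {nonneg R} := NngNum c_ge0.
have -> : empirical = (mscale c (msum m N) : set U -> \bar R).
  apply/funext => A; rewrite /empirical /mscale /msum /=; congr (_ * _).
  by apply: eq_bigr => j _; rewrite /m valKd.
exact: measure_semi_sigma_additive.
Qed.

HB.instance Definition _ := isMeasure.Build d U R empirical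
  empirical0 empirical_ge0 empirical_sigma_additive.

End Empirical.
Arguments empirical {d U} R {N} zeta.

Section Ambiguity.
Local Open Scope ereal_scope.
Context (R : realType) (m1 m2 : nat).
Local Notation V := ('cV[R]_m1 * 'cV[R]_m2)%type.

Definition couplings (P1 P2 : {measure set V -> \bar R}) :
    set (probability (V * V)%type R) :=
  [set G | forall A : set V, measurable A ->
     pushforward G fst A = P1 A /\ pushforward G snd A = P2 A].

Definition lp_dist (p : R) (xi1 xi2 : V) : R :=
  lp_norm p (col_mx (xi1.1 - xi2.1) (xi1.2 - xi2.2)).

Definition wasserstein_infty (p : R) (P1 P2 : {measure set V -> \bar R}) :
    \bar R :=
  ereal_inf [set ess_sup G (fun w : V * V => (lp_dist p w.1 w.2)%:E)
            | G in couplings P1 P2].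

Definition ambiguity_set (Xi : set V) (p theta : R) (N : nat)
    (zeta : 'I_N -> V) : set (probability V R) :=
  [set P : probability V R | P Xi = 1 /\
           wasserstein_infty p P (empirical R zeta) <= theta%:E].

(* The integral is taken over Xi because the recourse function is only meant
   to be evaluated there; every P in the ambiguity set has P Xi = 1. *)
Definition worst_case_expectation (Xi : set V) (p theta : R) (N : nat)
    (zeta : 'I_N -> V) (Z : V -> \bar R) : \bar R :=
  ereal_sup [set \int[P]_(xi in Xi) Z xi
            | P in ambiguity_set Xi p theta zeta].

End Ambiguity.

Section Integrality.
Context (R : realType).

Definition conv_hull (n : nat) (S : set 'cV[R]_n) : set 'cV[R]_n :=
  smallest (@convex_set R 'cV[R]_n) S.

Definition rational_polyhedron (n : nat) (P : set 'cV[R]_n) : Prop :=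
  exists (k : nat) (A : 'M[rat]_(k, n)) (b : 'cV[rat]_k),
    P = [set v | forall i, (map_mx ratr A *m v) i 0 <= ratr (b i 0)].

Definition integer_points (n : nat) : set 'cV[R]_n :=
  [set v | forall i, v i 0 \is a Num.int].

Definition integral_polyhedron (n : nat) (P : set 'cV[R]_n) : Prop :=
  rational_polyhedron P /\ P = conv_hull (P `&` @integer_points n).

End Integrality.

Section Binary.
Context (R : realType) (n2 m1 l : nat).

Definition binary_vectors : set 'cV[R]_m1 :=
  [set v | forall t, v t 0 = 0 \/ v t 0 = 1].

Definition coords0 (z : 'cV[R]_m1) : {set 'I_m1} :=
  finset (fun t => z t 0 == 0).

Definition coords1 (z : 'cV[R]_m1) : {set 'I_m1} :=
  finset (fun t => z t 0 == 1).

(* Points of R^l x R^m1 are encoded as stacked columns col_mx pi xiq. *)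
Definition budget_polyhedron (W : 'M[R]_(l, n2)) (Q : 'M[R]_(n2, m1))
    (q : 'cV[R]_n2) (z : 'cV[R]_m1) (kappa : nat) : set 'cV[R]_(l + m1) :=
  [set v : 'cV[R]_(l + m1) | let pi := usubmx v in let xiq := dsubmx v in
    [/\ forall i, 0 <= pi i 0,
        forall t, 0 <= xiq t 0 <= 1,
        W^T *m pi = Q *m xiq + q &
        \sum_(t in coords0 z) xiq t 0 + \sum_(t in coords1 z) (1 - xiq t 0)
          <= kappa%:R]].

End Binary.

(* Main.v *)
(* On binary supports sharing xi_T, the l_p distance is the p-th root of the
   Hamming distance, so a coupling of essential distance at most theta moves each
   zeta^j within the Hamming ball of radius floor(theta^p), and every such choice
   of points is realized by an empirical distribution. Hence Z(x) is the average
   over j of the maximum of the recourse function over the ball around zeta^j.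
   The minimization problem dominates that maximum by weak duality. Conversely,
   Farkas' lemma turns its optimal value into a point (pi, xi_q) of the budget
   polyhedron with dual objective at least this value; by integrality a convex
   open half-space cannot contain all integer points without containing the
   polyhedron, so the same bound is reached at a binary xi_q. *)
Require Import Defs.
From HB Require Import structures.
From mathcomp Require Import all_boot all_order all_algebra.
From mathcomp Require Import all_classical all_reals all_analysis.
From mathcomp Require Import unstable measurable_realfun ess_sup_inf ring lra.

Set Implicit Arguments.
Unset Strict Implicit.
Unset Printing Implicit Defensive.

Import Order.TTheory GRing.Theory Num.Theory.
Import numFieldNormedType.Exports.

Local Open Scope classical_set_scope.
Local Open Scope ring_scope.

(** * Farkas' lemma for linear forms *)

(* Bartl's induction: if [i] cannot be dropped, some [v] violates only [i]; all
   forms restricted to the kernel of [a i] along [v] satisfy the hypothesis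
   without [i]. *)
Lemma farkas_seq (R : realFieldType) (V : lmodType R) (I : eqType)
    (a : I -> {scalar V}) (c : {scalar V}) (s : seq I) : uniq s ->
    (forall x, (forall i, i \in s -> a i x <= 0) -> c x <= 0) ->
  exists u : I -> R, (forall i, 0 <= u i) /\
    forall x, c x = \sum_(i <- s) u i * a i x.
Proof.
elim: s => [|i s IHs] in a c * => [_|/= /andP[iNs us]] ac.
  exists (fun=> 0); split=> // x; rewrite big_nil; apply/eqP.
  rewrite eq_le ac //= -oppr_le0 -raddfN; exact: ac.
have [[v [av cv]]|] := pselect (exists v, (forall j, j \in s -> a j v <= 0) /\
                                   0 < c v); last first.
  move=> nv; have [|u [u0 cu]] := IHs a c us.
    by move=> x ax; rewrite leNgt; apply/negP => cx; apply: nv; exists x.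
  exists (fun j => if j == i then 0 else u j); split=> [j|x].
    by case: ifP.
  rewrite big_cons eqxx mul0r add0r cu; apply: eq_big_seq => j js.
  by case: eqP js => // ->; rewrite (negbTE iNs).
have aiv : 0 < a i v.
  rewrite ltNge; apply/negP => aiv; move: cv; rewrite ltNge ac// => j.
  by rewrite inE => /predU1P[->//|/av].
pose pr x := x - (a i x / a i v) *: v.
have pr_lin : linear pr.
  move=> k x y; rewrite /pr linearP mulrDl scalerDl -mulrA -scalerA scalerBr.
  by rewrite opprD addrACA.
pose prL : {linear V -> V} := HB.pack pr (GRing.isLinear.Build _ _ _ _ pr pr_lin).
pose a' j : {scalar V} := a j \o prL.
have [x ax|u [u0 cu]] := IHs a' (c \o prL : {scalar V}) us.
  apply: ac => j; rewrite inE => /predU1P[->|/ax//].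
  by rewrite /= /pr linearB linearZ /= divfK ?gt_eqF// subrr.
exists (fun j => if j == i then (c v - \sum_(j <- s) u j * a j v) / a i v else u j).
split=> [j|x].
  case: ifP => // _; apply: divr_ge0 (ltW aiv); rewrite subr_ge0.
  apply: le_trans (ltW cv); rewrite big_seq; apply: sumr_le0 => k ks.
  by rewrite mulr_ge0_le0 ?av.
rewrite big_cons eqxx; transitivity (c (pr x) + a i x / a i v * c v).
  by rewrite /pr linearB linearZ /= subrK.
rewrite [c _]cu [X in _ = _ + X](_ : _ = \sum_(j <- s) u j * a j x).
  rewrite [X in X + _](_ : _ = \sum_(j <- s) u j * a j x
      - a i x / a i v * \sum_(j <- s) u j * a j v).
    by field; rewrite gt_eqF.
  rewrite mulr_sumr -sumrB; apply: eq_bigr => j _.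
  by rewrite /= /pr linearB linearZ /=; ring.
apply: eq_big_seq => j js.
by case: eqP js => // ->; rewrite (negbTE iNs).
Qed.

Lemma farkas (R : realFieldType) (V : lmodType R) (I : finType)
    (a : I -> {scalar V}) (c : {scalar V}) :
    (forall x, (forall i, a i x <= 0) -> c x <= 0) ->
  exists u : I -> R, (forall i, 0 <= u i) /\
    forall x, c x = \sum_i u i * a i x.
Proof.
move=> ac; have [x ax|u [u0 cu]] := farkas_seq (a := a) (c := c) (index_enum_uniq I).
  by apply: ac => i; apply: ax; rewrite mem_index_enum.
by exists u.
Qed.

(** * Dot products of column vectors *)

Lemma dotvE (R : realType) (n : nat) (u v : 'cV[R]_n) :
  dotv u v = \sum_(i < n) u i 0 * v i 0.
Proof. by rewrite /dotv mxE; apply: eq_bigr => i _; rewrite mxE. Qed.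

Lemma dotvDl (R : realType) (n : nat) (u v w : 'cV[R]_n) :
  dotv (u + v) w = dotv u w + dotv v w.
Proof. by rewrite /dotv linearD mulmxDl mxE. Qed.

Lemma dotvDr (R : realType) (n : nat) (u v w : 'cV[R]_n) :
  dotv u (v + w) = dotv u v + dotv u w.
Proof. by rewrite /dotv mulmxDr mxE. Qed.

Lemma dotvZr (R : realType) (n : nat) (k : R) (u v : 'cV[R]_n) :
  dotv u (k *: v) = k * dotv u v.
Proof. by rewrite /dotv -scalemxAr mxE. Qed.

Lemma dotvC (R : realType) (n : nat) (u v : 'cV[R]_n) : dotv u v = dotv v u.
Proof. by rewrite !dotvE; apply: eq_bigr => i _; rewrite mulrC. Qed.

Lemma dotv_mull (R : realType) (m n : nat) (A : 'M[R]_(m, n)) u v :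
  dotv (A *m u) v = dotv u (A^T *m v).
Proof. by rewrite /dotv trmx_mul mulmxA. Qed.

Lemma dotv_delta (R : realType) (n : nat) (u : 'cV[R]_n) i :
  dotv u (delta_mx i 0) = u i 0.
Proof.
rewrite dotvE (bigD1 i)//= mxE !eqxx mulr1 big1 ?addr0// => j /negbTE ji.
by rewrite mxE ji mulr0.
Qed.

(** * The robust program and its linear programming dual *)

(** Here [b] and [r] stand for h(x) and T(x) xi_T, so that duality can be treated for a fixed
    decision x. *)
Definition robust_feasible (R : realType) (n2 m1 l : nat) (W : 'M[R]_(l, n2))
    (Q : 'M[R]_(n2, m1)) (b r : 'cV[R]_l) (z : 'cV[R]_m1) :
    set ('cV[R]_n2 * R * 'cV[R]_m1) :=
  [set s : 'cV[R]_n2 * R * 'cV[R]_m1 |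
     let y := s.1.1 in let lambda := s.1.2 in let sigma := s.2 in
     [/\ 0 <= lambda,
         forall t, 0 <= sigma t 0,
         forall i, b i 0 <= (r + W *m y) i 0,
         forall t, t \in coords0 z -> (Q^T *m y) t 0 <= lambda + sigma t 0 &
         forall t, t \in coords1 z -> - (Q^T *m y) t 0 <= lambda + sigma t 0]].

Definition robust_cost (R : realType) (n2 m1 : nat) (c : 'cV[R]_n2) (kappa : R)
    (s : 'cV[R]_n2 * R * 'cV[R]_m1) : R :=
  dotv c s.1.1 + kappa * s.1.2 + \sum_(t < m1) s.2 t 0.

(** Adding this sign to a binary coordinate flips it. It merges the constraints over [coords0] and
    [coords1] into a single family. *)
Definition flip_sign (R : realType) (m1 : nat) (z : 'cV[R]_m1) (t : 'I_m1) : R :=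
  if z t 0 == 0 then 1 else -1.

Section RobustDual.
Context (R : realType) (n2 m1 l : nat) (W : 'M[R]_(l, n2)) (Q : 'M[R]_(n2, m1)).
Context (b r : 'cV[R]_l) (z : 'cV[R]_m1).
Hypothesis z01 : binary_vectors z.

Local Notation sgn := (flip_sign z).

Lemma robust_feasibleP s : robust_feasible W Q b r z s <->
  [/\ 0 <= s.1.2, forall t, 0 <= s.2 t 0,
      forall i, (b - r) i 0 <= (W *m s.1.1) i 0 &
      forall t, sgn t * (Q^T *m s.1.1) t 0 <= s.1.2 + s.2 t 0].
Proof.
split=> [[l0 s0 bW f0 f1]|[l0 s0 bW f]]; split=> //.
- by move=> i; rewrite !mxE lerBlDl; have := bW i; rewrite !mxE.
- move=> t; rewrite /flip_sign; case: ifP => zt.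
    by rewrite mul1r f0// inE.
  by rewrite mulN1r f1// inE; case: (z01 t) zt => ->; rewrite eqxx.
- by move=> i; have := bW i; rewrite !mxE lerBlDl.
- by move=> t; rewrite inE => zt; have := f t; rewrite /flip_sign zt mul1r.
- move=> t; rewrite inE => /eqP zt; have := f t.
  by rewrite /flip_sign zt oner_eq0 mulN1r.
Qed.

(** A [lambda] as large as the sum of all |(Q^T y)_t| satisfies every flip constraint with [sigma]
    zero. *)
Lemma robust_feasible_ex y : (forall i, b i 0 <= (r + W *m y) i 0) ->
  exists s, robust_feasible W Q b r z s.
Proof.
move=> bW; exists (y, \sum_t `|(Q^T *m y) t 0|, 0); split=> //=.
- exact: sumr_ge0.
- by move=> t; rewrite mxE.
- move=> t _; rewrite [X in _ + X]mxE addr0 (le_trans (ler_norm _))//.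
  by rewrite (bigD1 t)//= lerDl sumr_ge0.
- move=> t _; rewrite [X in _ + X]mxE addr0 (le_trans (ler_norm _))// normrN.
  by rewrite (bigD1 t)//= lerDl sumr_ge0.
Qed.

(** Strong duality in a form that needs no optimal solution: any lower bound [M] of the program is
    matched by a dual point. The Farkas multipliers of the recourse constraints form pi, and those
    of the flip constraints say how far each coordinate of [z] is moved. *)
Lemma robust_dual (q : 'cV[R]_n2) (kappa : nat) (M : R) :
    (exists s, robust_feasible W Q b r z s) ->
    (forall s, robust_feasible W Q b r z s ->
       M <= robust_cost (Q *m z + q) kappa%:R s) ->
  exists2 v, budget_polyhedron W Q q z kappa v & M <= dotv (b - r) (usubmx v).
Proof.
move=> [s0 /robust_feasibleP[l0_ge0 s0_ge0 bW0 f0]] minM.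
set c := Q *m z + q.
(* points are (y, lambda, sigma, tau), with [tau] homogenizing the program *)
pose V : lmodType R := ('cV[R]_n2 * R^o * 'cV[R]_m1 * R^o)%type.
pose cst (v : V) : R := robust_cost c kappa%:R v.1.
pose obj (v : V) : R := M * v.2 - cst v.
pose a (i : 'I_l + 'I_m1 + ('I_m1 + bool)) (v : V) : R :=
  match i with
  | inl (inl i) => (b - r) i 0 * v.2 - (W *m v.1.1.1) i 0
  | inl (inr t) => sgn t * (Q^T *m v.1.1.1) t 0 - (v.1.1.2 + v.1.2 t 0)
  | inr (inl t) => - v.1.2 t 0
  | inr (inr true) => - v.1.1.2
  | inr (inr false) => - v.2
  end.
have scaleE (k : R) (t : R^o) : k *: t = k * t by [].
have a_lin i : scalar (a i).
  move=> k u v; case: i => [[i|t]|[t|[]]] /=;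
    rewrite ?mulmxDr -?scalemxAr ?mxE /= ?scaleE; ring.
have cst_lin : scalar cst.
  move=> k u v; rewrite /cst /robust_cost /= dotvDr dotvZr scaleE.
  under eq_bigr do rewrite !mxE.
  by rewrite big_split/= -mulr_sumr; ring.
have obj_lin : scalar obj.
  by move=> k u v; rewrite /obj cst_lin /= scaleE; ring.
pose aL i : {scalar V} := HB.pack (a i) (GRing.isLinear.Build _ _ _ _ _ (a_lin i)).
pose objL : {scalar V} := HB.pack obj (GRing.isLinear.Build _ _ _ _ _ obj_lin).
have [v av|u [u0 cu]] := @farkas R V _ aL objL.
  have av1 i : (b - r) i 0 * v.2 <= (W *m v.1.1.1) i 0.
    by rewrite -subr_le0; apply: (av (inl (inl i))).
  have av2 t : sgn t * (Q^T *m v.1.1.1) t 0 <= v.1.1.2 + v.1.2 t 0.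
    by rewrite -subr_le0; apply: (av (inl (inr t))).
  have av3 t : 0 <= v.1.2 t 0 by rewrite -oppr_le0; apply: (av (inr (inl t))).
  have av4 : 0 <= v.1.1.2 by rewrite -oppr_le0; apply: (av (inr (inr true))).
  have av5 : 0 <= v.2 by rewrite -oppr_le0; apply: (av (inr (inr false))).
  (* Since [v.2] may be zero, [v] itself cannot be rescaled to a point of the program. Mixing in the
     feasible point [s0] with weight [e] makes the last coordinate positive. If A = [obj v] were
     positive, the bound [M] at the rescaled point would give A <= e * D, which e = A / (D + 1)
     contradicts; the added 1 also covers D = 0. *)
  pose D := cst (s0, 1) - M.
  have D0 : 0 <= D by rewrite subr_ge0; apply: minM; apply/robust_feasibleP.
  rewrite /= /obj; set A := M * _ - _; rewrite leNgt; apply/negP => A0.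
  pose e := A / (D + 1); have e0 : 0 < e by apply: divr_gt0 => //; lra.
  have te0 : 0 < v.2 + e by lra.
  pose w : V := (v.2 + e)^-1 *: ((e *: ((s0, 1) : V)) + v).
  have w_feas : robust_feasible W Q b r z w.1.
    have te_inv : 0 <= (v.2 + e)^-1 by rewrite invr_ge0 ltW.
    apply/robust_feasibleP; split=> /=.
    - apply: mulr_ge0 => //; apply: addr_ge0 => //.
      by apply: mulr_ge0 => //; exact: ltW.
    - move=> t; rewrite !mxE; apply: mulr_ge0 => //; apply: addr_ge0 => //.
      by apply: mulr_ge0 => //; exact: ltW.
    - move=> i; rewrite -scalemxAr mulmxDr -scalemxAr [leRHS]mxE.
      rewrite ler_pdivlMl// [leRHS]mxE mulrC mulrDr addrC lerD//.
      by rewrite [leRHS]mxE mulrC ler_wpM2l// ltW.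
    - move=> t; rewrite -scalemxAr mulmxDr -scalemxAr ![in leLHS]mxE /= ![in leRHS]mxE.
      rewrite mulrCA -mulrDr; apply: ler_wpM2l => //.
      rewrite mulrDr addrACA lerD//; last first.
        by have := av2 t; rewrite !mxE.
      rewrite mulrCA -mulrDr ler_wpM2l ?(ltW e0)//.
      by have := f0 t; rewrite !mxE.
  have := minM _ w_feas; rewrite -/c -/(cst w).
  have -> : cst w = (v.2 + e)^-1 * (e * cst (s0, 1) + cst v).
    have -> : cst w = (v.2 + e)^-1 * cst (e *: ((s0, 1) : V) + v).
      have := cst_lin (v.2 + e)^-1 (e *: ((s0, 1) : V) + v) 0.
      rewrite addr0 => ->; suff -> : cst 0 = 0 by rewrite addr0.
      by have := cst_lin (-1) 0 0; rewrite scaler0 addr0 mulN1r addNr.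
    by rewrite cst_lin.
  rewrite ler_pdivlMl// => h.
  have : A <= e * D by rewrite /A /D; lra.
  rewrite /e -mulrA [_^-1 * _]mulrC; apply/negP.
  by rewrite -ltNge gtr_pMr// ltr_pdivrMr; lra.
pose pi : 'cV[R]_l := \col_i u (inl (inl i)).
pose w t := u (inl (inr t)).
pose sw : 'cV[R]_m1 := \col_t (sgn t * w t).
(* The Farkas certificate is an identity between linear forms. Evaluating it at one unit coordinate
   at a time reads off the dual constraints: [sigma] gives w <= 1, [lambda] gives the budget, the
   homogenizing variable gives the bound on [M], and [y] gives the equation for pi. *)
have {}cu (y : 'cV[R]_n2) (lambda : R) (sigma : 'cV[R]_m1) (tau : R) :
    M * tau - robust_cost c kappa%:R (y, lambda, sigma) =
    dotv (b - r) pi * tau - dotv (W^T *m pi) y + dotv (Q *m sw) y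
    - (\sum_t w t + u (inr (inr true))) * lambda
    - \sum_t (w t + u (inr (inl t))) * sigma t 0 - u (inr (inr false)) * tau.
  have := cu (y, lambda, sigma, tau).
  rewrite !big_sumType /= big_bool /= /obj /cst => ->.
  have -> : \sum_i u (inl (inl i)) * ((b - r) i 0 * tau - (W *m y) i 0) =
      dotv (b - r) pi * tau - dotv (W^T *m pi) y.
    rewrite dotv_mull trmxK !dotvE mulr_suml -sumrB; apply: eq_bigr => i _.
    by rewrite [pi _ _]mxE; ring.
  have -> : \sum_t w t * (sgn t * (Q^T *m y) t 0 - (lambda + sigma t 0)) =
      dotv (Q *m sw) y - (\sum_t w t) * lambda - \sum_t w t * sigma t 0.
    rewrite dotv_mull dotvE mulr_suml -!sumrB; apply: eq_bigr => t _.
    by rewrite [sw _ _]mxE; ring.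
  have -> : \sum_t (w t + u (inr (inl t))) * sigma t 0 =
      \sum_t w t * sigma t 0 - \sum_t u (inr (inl t)) * - sigma t 0.
    by rewrite -sumrB; apply: eq_bigr => t _; ring.
  ring.
have dotv0 n (v : 'cV[R]_n) : dotv v 0 = 0.
  by rewrite dotvE big1// => i _; rewrite mxE mulr0.
have sum0 (f : 'I_m1 -> R) : \sum_t f t * (0 : 'cV[R]_m1) t 0 = 0.
  by rewrite big1// => t _; rewrite mxE mulr0.
have sum0' : \sum_t (0 : 'cV[R]_m1) t 0 = 0 by rewrite big1// => t _; rewrite mxE.
have w_le1 t : w t <= 1.
  have := cu 0 0 (delta_mx t 0) 0; rewrite /robust_cost /= !dotv0.
  have delta_sum (f : 'I_m1 -> R) :
      \sum_s f s * (delta_mx t 0 : 'cV[R]_m1) s 0 = f t.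
    rewrite (bigD1 t)//= mxE !eqxx mulr1 big1 ?addr0// => s /negbTE st.
    by rewrite mxE st mulr0.
  have /= := delta_sum (fun=> 1); under eq_bigr do rewrite mul1r.
  by move=> ->; rewrite delta_sum; have := u0 (inr (inl t)); lra.
have w_sum : \sum_t w t <= kappa%:R.
  have := cu 0 1 0 0; rewrite /robust_cost /= !dotv0 sum0 sum0'.
  by have := u0 (inr (inr true)); lra.
have M_le : M <= dotv (b - r) pi.
  have := cu 0 0 0 1; rewrite /robust_cost /= !dotv0 sum0 sum0'.
  by have := u0 (inr (inr false)); lra.
have WQ : W^T *m pi = Q *m (z + sw) + q.
  apply/matrixP => j k; rewrite ord1.
  have := cu (delta_mx j 0) 0 0 0; rewrite /robust_cost /= !dotv_delta sum0 sum0'.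
  by move=> E; rewrite mulmxDr addrAC -/c [RHS]mxE; lra.
(* Each coordinate of [z] moves by [w t], between 0 and 1, towards its opposite bound. It therefore
   stays in [0,1] and uses exactly [w t] of the budget. *)
exists (col_mx pi (z + sw)); last by rewrite col_mxKu.
rewrite /budget_polyhedron /= col_mxKu col_mxKd; split=> //.
- by move=> i; rewrite mxE.
- move=> t; rewrite !mxE /flip_sign; have := w_le1 t.
  have : 0 <= w t by exact: u0.
  by case: (z01 t) => ->; rewrite ?eqxx ?oner_eq0; lra.
- apply: le_trans w_sum; rewrite big_mkcond [X in _ + X]big_mkcond -big_split /=.
  apply: ler_sum => t _; rewrite !inE !mxE /flip_sign.
  by case: (z01 t) => ->; rewrite ?eqxx ?oner_eq0 1?eq_sym ?oner_eq0; lra.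
Qed.

End RobustDual.

(** * Hamming balls and integrality of the budget polyhedron *)

Definition hamming (R : realType) (m : nat) (u v : 'cV[R]_m) : R :=
  \sum_(t < m) `|u t 0 - v t 0|.

Lemma hammingxx (R : realType) (m : nat) (u : 'cV[R]_m) : hamming u u = 0.
Proof. by rewrite /hamming big1// => t _; rewrite subrr normr0. Qed.

(** The convex hull is the smallest convex superset, so it is used by testing against a convex set;
    this half-space is the test set. *)
Lemma convex_set_dotv_lt (R : realType) (n : nat) (g : 'cV[R]_n) (M : R) :
  @convex_set R 'cV[R]_n [set v | dotv g v < M].
Proof.
move=> u v k; rewrite !inE /= -subr_gt0 => gu; rewrite -subr_gt0 => gv.
rewrite -subr_gt0.
have -> : M - dotv g (conv k (u : convex_lmodType 'cV[R]_n) v) =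
    conv k (M - dotv g u : R^o) (M - dotv g v : R^o).
  by rewrite convRE [dotv g _]dotvDr !dotvZr /unstable.onem; ring.
exact: convR_gt0.
Qed.

(** Suppose every binary point of the ball has a feasible [y] of cost below [M]. Weak duality for
    the recourse problem then puts each integer point of the polyhedron into the open half-space of
    dual objective below [M]. By integrality the whole polyhedron lies there, including the dual
    point from [robust_dual]. Quantifying over [y] in the conclusion avoids a second appeal to
    strong duality. *)
Lemma robust_dual_integral (R : realType) (n2 m1 l : nat) (W : 'M[R]_(l, n2))
    (Q : 'M[R]_(n2, m1)) (q : 'cV[R]_n2) (b r : 'cV[R]_l) (z : 'cV[R]_m1)
    (kappa : nat) (M : R) :
    binary_vectors z ->
    integral_polyhedron (budget_polyhedron W Q q z kappa) ->
    (exists s, robust_feasible W Q b r z s) ->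
    (forall s, robust_feasible W Q b r z s ->
       M <= robust_cost (Q *m z + q) kappa%:R s) ->
  exists xi, [/\ binary_vectors xi, hamming xi z <= kappa%:R &
    forall y, (forall i, b i 0 <= (r + W *m y) i 0) ->
      M <= dotv (Q *m xi + q) y].
Proof.
move=> z01 [_ integral] feas minM.
have [v Pv Mv] := robust_dual z01 feas minM.
apply: contrapT => no_xi.
pose g : 'cV[R]_(l + m1) := col_mx (b - r) 0.
have gE w : dotv g w = dotv (b - r) (usubmx w).
  rewrite -{1}[w]vsubmxK /g /dotv tr_col_mx mul_row_col trmx0 mul0mx addr0.
  by [].
suff : dotv g v < M by rewrite gE ltNge Mv.
move: (Pv); rewrite integral => /(_ [set w | dotv g w < M]); apply.
split; first exact: convex_set_dotv_lt.
move=> {Pv Mv} {}v [[pi_ge0 xi_01 WQ xi_le] v_int] /=; rewrite gE.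
set pi := usubmx v in pi_ge0 WQ *; set xi := dsubmx v in xi_01 WQ xi_le.
have xi_bin : binary_vectors xi.
  move=> t; have /intrP[k xik] : xi t 0 \is a Num.int by rewrite /xi mxE.
  move: (xi_01 t); rewrite xik => /andP[k_ge0 k_le1].
  have {k_ge0} : (0 <= k)%R by rewrite -(ler0z R).
  have {k_le1} : (k <= 1)%R by rewrite -(lerz1 R).
  by case: k {xik} => [[|[]]|]//; [left|right].
have [y Wy yM] : exists2 y, (forall i, b i 0 <= (r + W *m y) i 0) &
    dotv (Q *m xi + q) y < M.
  apply: contrapT => no_y; apply: no_xi; exists xi; split=> //.
    apply: le_trans xi_le.
    rewrite big_mkcond [X in _ + X]big_mkcond -big_split /=.
    apply: ler_sum => t _; rewrite !inE.
    have /andP[] := xi_01 t => xit0 xit1.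
    case: (z01 t) => ->; rewrite ?eqxx ?oner_eq0 1?eq_sym ?oner_eq0.
      by rewrite subr0 ger0_norm// addr0.
    by rewrite distrC ger0_norm ?subr_ge0// add0r.
  move=> y Wy; rewrite leNgt; apply/negP => yM; apply: no_y; by exists y.
apply: le_lt_trans yM; rewrite -WQ dotv_mull trmxK [leRHS]dotvC !dotvE.
apply: ler_sum => i _; apply: ler_wpM2r => //.
by have := Wy i; rewrite !mxE lerBlDl.
Qed.

(** Moving from [z] to [xi] changes the cost only at flipped coordinates, each contributing at most
    [lambda] plus its [sigma]. At most [kappa] coordinates are flipped, and the remaining [sigma]
    are nonnegative. *)
Lemma robust_weak_dual (R : realType) (n2 m1 l : nat) (W : 'M[R]_(l, n2))
    (Q : 'M[R]_(n2, m1)) (q : 'cV[R]_n2) (b r : 'cV[R]_l) (z xi : 'cV[R]_m1)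
    (kappa : R) s :
    binary_vectors z -> binary_vectors xi -> hamming xi z <= kappa ->
    robust_feasible W Q b r z s ->
  dotv (Q *m xi + q) s.1.1 <= robust_cost (Q *m z + q) kappa s.
Proof.
move=> z01 xi01 xiz [l_ge0 s_ge0 _ f0 f1].
have -> : Q *m xi + q = (Q *m z + q) + Q *m (xi - z).
  by rewrite mulmxBr; apply/matrixP => i j; rewrite !mxE; ring.
rewrite dotvDl /robust_cost -addrA lerD2l dotv_mull dotvE.
apply: (@le_trans _ _ (hamming xi z * s.1.2 + \sum_t s.2 t 0)); last first.
  by rewrite lerD2r ler_wpM2r.
rewrite mulr_suml -big_split /=; apply: ler_sum => t _.
rewrite [(xi - z) t 0]mxE [(- z) t 0]mxE.
have := s_ge0 t; have := f0 t; have := f1 t; rewrite !inE.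
case: (z01 t) => ->; case: (xi01 t) => ->;
  rewrite ?eqxx ?oner_eq0 1?eq_sym ?oner_eq0 ?subrr ?subr0 ?sub0r;
  rewrite ?normrN ?normr1 ?normr0 ?mul0r ?mul1r ?mulN1r ?add0r; lra.
Qed.

Definition robust_value (R : realType) (n2 m1 l : nat) (W : 'M[R]_(l, n2))
    (Q : 'M[R]_(n2, m1)) (q : 'cV[R]_n2) (b r : 'cV[R]_l) (kappa : R)
    (z : 'cV[R]_m1) : \bar R :=
  ereal_inf [set (robust_cost (Q *m z + q) kappa s)%:E
            | s in robust_feasible W Q b r z].

(** * Comparison of the recourse function with the robust value *)

Section RecourseBounds.
Context (R : realType) (n1 n2 m1 m2 l : nat) (W : 'M[R]_(l, n2)).
Context (Q : 'M[R]_(n2, m1)) (q : 'cV[R]_n2) (h : 'cV[R]_n1 -> 'cV[R]_l).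
Context (T : 'cV[R]_n1 -> 'M[R]_(l, m2)) (x : 'cV[R]_n1) (xiT : 'cV[R]_m2).

Local Notation Z := (fun xi => recourse W Q q h T x (xi, xiT)).
Local Notation V kappa := (robust_value W Q q (h x) (T x *m xiT) kappa).
Local Notation feasible := (recourse_feasible W h T x xiT).

Lemma recourse_le_robust_value kappa z xi :
    binary_vectors z -> binary_vectors xi -> hamming xi z <= kappa ->
  (Z xi <= V kappa z)%E.
Proof.
move=> z01 xi01 xiz; apply: le_ereal_inf_tmp => _ [s sf <-].
apply: (@le_trans _ _ (dotv (Q *m xi + q) s.1.1)%:E).
  by apply: ereal_inf_lbound; exists s.1.1 => //; case: sf.
by rewrite lee_fin; exact: robust_weak_dual sf.
Qed.

Lemma robust_value_attained (kappa : nat) z :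
    binary_vectors z ->
    integral_polyhedron (budget_polyhedron W Q q z kappa) ->
    feasible !=set0 ->
  exists xi, [/\ binary_vectors xi, hamming xi z <= kappa%:R &
    (V kappa%:R z <= Z xi)%E].
Proof.
move=> z01 integral [y yf].
have [s sf] := robust_feasible_ex Q z yf.
have Vle s' : robust_feasible W Q (h x) (T x *m xiT) z s' ->
    (V kappa%:R z <= (robust_cost (Q *m z + q) kappa%:R s')%:E)%E.
  by move=> ?; apply: ereal_inf_lbound; exists s'.
(* A finite value is handled by integral duality, the feasible [s] excludes +oo, and for -oo the
   center [z] itself will do. *)
case EV : (V kappa%:R z) => [M||].
- have [|s' s'f|xi [xi01 xiz Mxi]] :=
    @robust_dual_integral R n2 m1 l W Q q (h x) (T x *m xiT) z kappa M z01 integral.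
  + by exists s.
  + by rewrite -lee_fin -EV Vle.
  exists xi; split=> //.
  by apply: le_ereal_inf_tmp => _ [y' y'f <-]; rewrite lee_fin Mxi.
- by have := Vle _ sf; rewrite EV.
- by exists z; split; rewrite ?hammingxx ?ler0n ?leNye.
Qed.

(** A feasible [y] bounds the infimum from above; the dual point supplied by expensive recourse
    bounds it from below. *)
Lemma recourse_fin_num xi : feasible !=set0 ->
    (exists pi : 'cV[R]_l, (forall i, 0 <= pi i 0) /\ W^T *m pi = Q *m xi + q) ->
  Z xi \is a fin_num.
Proof.
move=> [y yf] [pi [pi_ge0 WQ]]; rewrite fin_numE -ltNye -ltey; apply/andP; split.
  apply: (@lt_le_trans _ _ (dotv pi (h x - T x *m xiT))%:E); first exact: ltNyr.
  apply: le_ereal_inf_tmp => _ [y' y'f <-].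
  rewrite lee_fin -WQ dotv_mull trmxK !dotvE; apply: ler_sum => i _.
  by apply: ler_wpM2l => //; have := y'f i; rewrite !mxE lerBlDl.
apply: (@le_lt_trans _ _ (dotv (Q *m xi + q) y)%:E); last exact: ltry.
by apply: ereal_inf_lbound; exists y.
Qed.

Lemma robust_value_fin_num (kappa : nat) z :
    binary_vectors z -> feasible !=set0 ->
    (exists pi : 'cV[R]_l, (forall i, 0 <= pi i 0) /\ W^T *m pi = Q *m z + q) ->
  V kappa%:R z \is a fin_num.
Proof.
move=> z01 yf pif; have Zfin := recourse_fin_num yf pif.
rewrite fin_numE -ltNye -ltey; apply/andP; split.
  apply: (@lt_le_trans _ _ (Z z)).
    by move: Zfin; rewrite fin_numElt => /andP[].
  by apply: recourse_le_robust_value; rewrite ?hammingxx.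
have [y {}yf] := yf; have [s sf] := robust_feasible_ex Q z yf.
apply: (@le_lt_trans _ _ (robust_cost (Q *m z + q) kappa%:R s)%:E); last exact: ltry.
by apply: ereal_inf_lbound; exists s.
Qed.

Lemma recourse_infeasible xi : ~ (feasible !=set0) -> Z xi = +oo%E.
Proof.
move=> nf; rewrite /recourse [X in ereal_inf X](_ : _ = set0) ?ereal_inf0//.
by apply/seteqP; split=> // t [y yf _]; apply: nf; exists y.
Qed.

Lemma robust_value_infeasible kappa z : ~ (feasible !=set0) -> V kappa z = +oo%E.
Proof.
move=> nf; rewrite /robust_value [X in ereal_inf X](_ : _ = set0) ?ereal_inf0//.
by apply/seteqP; split=> // t [s [_ _ yf _ _] _]; apply: nf; exists s.1.1.
Qed.

End RecourseBounds.

(** * Hamming distance, l_p distance and the radius *)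

Lemma powRK (R : realType) (a p : R) : 0 <= a -> p != 0 -> (a `^ p) `^ p^-1 = a.
Proof. by move=> a0 p0; rewrite -powRrM divff// powRr1. Qed.

Section Hamming.
Context (R : realType) (m1 m2 : nat).

Lemma hamming_ge0 (u v : 'cV[R]_m1) : 0 <= hamming u v.
Proof. exact: sumr_ge0. Qed.

Lemma hamming_int (u v : 'cV[R]_m1) : binary_vectors u -> binary_vectors v ->
  hamming u v \is a Num.int.
Proof.
move=> u01 v01; apply: rpred_sum => t _.
by case: (u01 t) => ->; case: (v01 t) => ->;
  rewrite ?subrr ?subr0 ?sub0r ?normrN ?normr0 ?normr1 ?rpred0 ?rpred1.
Qed.

(** Hamming distances of binary vectors are integers. The strict form is what an infimum over
    couplings that may not be attained can deliver. *)
Lemma hamming_le_floor (u v : 'cV[R]_m1) (a : R) :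
    binary_vectors u -> binary_vectors v ->
  (hamming u v <= (Num.floor a)%:~R) = (hamming u v < (Num.floor a + 1)%:~R).
Proof.
move=> u01 v01; have /intrP[k ->] := hamming_int u01 v01.
by rewrite ler_int ltr_int ltzD1.
Qed.

(** Coordinate differences have absolute value 0 or 1, which the p-th power fixes; p = 0 must be
    excluded because 0 to the power 0 is 1. The second block vanishes. *)
Lemma lp_dist_hamming (p : R) (xi z : 'cV[R]_m1 * 'cV[R]_m2) : p != 0 ->
    binary_vectors xi.1 -> binary_vectors z.1 -> xi.2 = z.2 ->
  lp_dist p xi z = hamming xi.1 z.1 `^ p^-1.
Proof.
move=> p0 xi01 z01 xiz; rewrite /lp_dist /lp_norm; congr (_ `^ _).
rewrite big_split_ord /= [X in _ + X]big1 ?addr0 => [|t _]; last first.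
  by rewrite col_mxEd xiz subrr mxE normr0 powR0.
apply: eq_bigr => t _; rewrite col_mxEu !mxE.
by case: (xi01 t) => ->; case: (z01 t) => ->;
  rewrite ?subrr ?subr0 ?sub0r ?normrN ?normr0 ?normr1 ?powR0 ?powR1.
Qed.

Lemma hamming_powR_le (theta p : R) (u v : 'cV[R]_m1) : 0 <= theta -> 0 < p ->
  hamming u v <= (Num.floor (theta `^ p))%:~R -> hamming u v `^ p^-1 <= theta.
Proof.
move=> theta0 p0 uv; rewrite -[leRHS](powRK theta0 (lt0r_neq0 p0)).
apply: ge0_ler_powR; rewrite ?invr_ge0 ?(ltW p0)// ?nnegrE ?hamming_ge0 ?powR_ge0//.
exact: le_trans uv (floor_le _).
Qed.

Lemma lt_floor_powR (theta p : R) : 0 <= theta -> 0 < p ->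
  theta < (Num.floor (theta `^ p) + 1)%:~R `^ p^-1.
Proof.
move=> theta0 p0; rewrite -[ltLHS](powRK theta0 (lt0r_neq0 p0)).
have /andP[_ ltf] := floor_itv (theta `^ p).
apply: gt0_ltr_powR; rewrite ?invr_gt0// ?nnegrE ?powR_ge0//.
by rewrite (le_trans _ (ltW ltf))// powR_ge0.
Qed.

Lemma powR_hamming_lt (a p : R) (u v : 'cV[R]_m1) : 0 <= a -> 0 < p ->
  hamming u v `^ p^-1 < a `^ p^-1 -> hamming u v < a.
Proof.
move=> a0 p0; apply: contraTT; rewrite -!leNgt => ah.
by apply: ge0_ler_powR; rewrite ?invr_ge0 ?(ltW p0)// ?nnegrE ?hamming_ge0.
Qed.

End Hamming.

(** * Integration over finite supports and along couplings *)

Lemma measurable_set1_col (R : realType) n (u : 'cV[R]_n) : measurable [set u].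
Proof.
rewrite -[[set u]]setCK; apply: measurableC; apply: sub_sigma_algebra.
apply: closed_openC; apply: accessible_closed_set1.
exact: hausdorff_accessible (@norm_hausdorff R 'cV[R]_n).
Qed.

Lemma measurable_set1_pair d1 d2 (T1 : measurableType d1) (T2 : measurableType d2)
    (t : T1 * T2) :
  measurable [set t.1] -> measurable [set t.2] -> measurable [set t].
Proof.
move=> mt1 mt2; rewrite (_ : [set t] = [set t.1] `*` [set t.2]).
  exact: measurableX.
case: t {mt1 mt2} => t1 t2; apply/seteqP.
by split=> [_ ->//|[u1 u2] [/= -> ->]].
Qed.

Lemma finite_measurable d (T : measurableType d) (D : set T) :
  (forall t : T, measurable [set t]) -> finite_set D -> measurable D.
Proof.
by move=> m1 finD; apply: countable_measurable => //; exact: finite_set_countable.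
Qed.

Lemma finite_measurable_fun d (T : measurableType d) d' (T' : measurableType d')
    (D : set T) (f : T -> T') :
  (forall t : T, measurable [set t]) -> finite_set D -> measurable_fun D f.
Proof.
move=> m1 finD mD Y mY; apply: finite_measurable => //.
by apply: sub_finite_set finD => t [].
Qed.

(** The patched function takes finitely many finite values on [D] and 0 elsewhere, so it is bounded,
    hence integrable for a probability. The map [phi] will be a projection of a coupling. *)
Lemma finite_patch_integrable (R : realType) d1 (X : measurableType d1)
    (P : probability X R) d (T : measurableType d) (phi : X -> T) (D : set T)
    (f : T -> \bar R) :
    (forall t : T, measurable [set t]) -> finite_set D ->
    measurable_fun setT phi -> (forall t, D t -> f t \is a fin_num) ->
  P.-integrable setT ((f \_ D) \o phi).
Proof.
move=> m1 finD mphi ffin.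
have fD_fin t : (f \_ D) t \is a fin_num.
  by rewrite patchE; case: ifPn => // /set_mem; exact: ffin.
have mD : measurable D := finite_measurable m1 finD.
rewrite (_ : _ \o phi = EFin \o (fine \o ((f \_ D) \o phi))); last first.
  by apply/funext => t /=; rewrite fineK.
have mfD : measurable_fun setT (f \_ D : T -> \bar R).
  apply/(measurable_restrict f mD measurableT).
  by rewrite setTI; exact: finite_measurable_fun.
apply: measurable_bounded_integrable => //.
- by rewrite (le_lt_trans (probability_le1 P measurableT))// ltry.
- do 2![apply: measurableT_comp => //].
- have : bounded_set [set (fine \o f) t | t in D].
    by apply: compact_bounded; apply: finite_compact; exact: finite_image.
  rewrite /bounded_near /=; apply: filterS2 (nbhs_pinfty_ge (num_real 0)).
  move=> M M0 fM t _ /=; rewrite patchE; case: ifPn => [/set_mem Dt|_].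
    by apply: (fM (fine (f (phi t)))); exists (phi t).
  by rewrite /= normr0.
Qed.

(** Both integrals are pulled back to the coupling [G]. Outside a null set both coordinates lie in
    [D] and the pair is good, so the integrands compare pointwise. *)
Lemma le_integral_coupling (R : realType) d (T : measurableType d)
    (P E : {measure set T -> \bar R}) (G : probability (T * T)%type R)
    (D : set T) (good : set (T * T)) (f g : T -> \bar R) :
    (forall t : T, measurable [set t]) -> finite_set D ->
    (forall A, measurable A -> pushforward G fst A = P A) ->
    (forall A, measurable A -> pushforward G snd A = E A) ->
    P (~` D) = 0%E -> E (~` D) = 0%E -> {ae G, forall w, good w} ->
    (forall t, D t -> f t \is a fin_num) -> (forall t, D t -> g t \is a fin_num) ->
    (forall w, D w.1 -> D w.2 -> good w -> (f w.1 <= g w.2)%E) ->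
  (\int[P]_(t in D) f t <= \int[E]_(t in D) g t)%E.
Proof.
move=> m1 finD GP GE PD ED [N [mN N0 Ngood]] ffin gfin fg.
have mD : measurable D := finite_measurable m1 finD.
have mpatch (k : T -> \bar R) : measurable_fun setT (k \_ D : T -> \bar R).
  apply/(measurable_restrict k mD measurableT).
  by rewrite setTI; exact: finite_measurable_fun.
have fint := finite_patch_integrable G m1 finD measurable_fst ffin.
have gint := finite_patch_integrable G m1 finD measurable_snd gfin.
rewrite integral_mkcond [leRHS]integral_mkcond.
rewrite -(eq_measure_integral P (fun A mA _ => GP A mA)).
rewrite -(eq_measure_integral E (fun A mA _ => GE A mA)).
rewrite !integral_pushforward//; try exact: measurableT.
have mDf : measurable ((fst : T * T -> T) @^-1` (~` D)).
  by rewrite -[X in measurable X]setTI; apply: measurable_fst => //; exact: measurableC.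
have mDs : measurable ((snd : T * T -> T) @^-1` (~` D)).
  by rewrite -[X in measurable X]setTI; apply: measurable_snd => //; exact: measurableC.
pose B := N `|` (fst @^-1` (~` D) `|` snd @^-1` (~` D)).
have mB : measurable B by apply: measurableU => //; exact: measurableU.
have B0 : G B = 0%E.
  apply: null_set_setU => //; first exact: measurableU.
  apply: null_set_setU => //.
    by rewrite -PD -GP//; exact: measurableC.
  by rewrite -ED -GE//; exact: measurableC.
rewrite !preimage_setT.
rewrite (negligible_integral mB measurableT fint B0).
rewrite [leRHS](negligible_integral mB measurableT gint B0).
have mCB : measurable (setT `\` B) by exact: measurableD.
apply: le_integral => //.
- exact: integrableS fint.
- exact: integrableS gint.
move=> w; rewrite inE => -[_ nB] /=.
have Dw1 : D w.1 by apply: contrapT => nD; apply: nB; right; left.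
have Dw2 : D w.2 by apply: contrapT => nD; apply: nB; right; right.
rewrite !patchE !mem_set//; apply: fg => //.
by apply: contrapT => ng; apply: nB; left; apply: Ngood.
Qed.

(** * Empirical distributions and their integrals *)

(** Nonnegativity in place of finiteness allows the value +oo, which the recourse function takes
    when the recourse problem is infeasible. *)
Lemma ge0_integral_empirical (R : realType) d (T : measurableType d) (N : nat)
    (zeta : 'I_N -> T) (D : set T) (f : T -> \bar R) :
    measurable D -> measurable_fun D f -> (forall t, D t -> (0 <= f t)%E) ->
    (forall j, D (zeta j)) -> (0 < N)%N ->
  (\int[empirical R zeta]_(t in D) f t = (N%:R^-1)%:E * \sum_(j < N) f (zeta j))%E.
Proof.
move=> mD mf f0 Dzeta N_gt0; have c_ge0 : (0 <= (N%:R : R)^-1)%R by rewrite invr_ge0.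
(* [msum] is indexed by natural numbers: [insubd] returns the index k for k < N and a default index
   beyond. *)
pose m (k : nat) : {measure set T -> \bar R} :=
  \d_(zeta (insubd (Ordinal N_gt0) k)).
rewrite (eq_measure_integral (mscale (NngNum c_ge0) (msum m N))); last first.
  move=> A mA _; rewrite /empirical /mscale /msum /=; congr (_ * _)%E.
  by apply: eq_bigr => j _; rewrite /m valKd.
rewrite ge0_integral_mscale// ge0_integral_measure_sum//; congr (_ * _)%E.
by apply: eq_bigr => j _; rewrite integral_dirac// valKd diracE mem_set ?mul1e//.
Qed.

Section EmpiricalFacts.
Context (R : realType) d (T : measurableType d) (N : nat) (zeta : 'I_N -> T).
Hypothesis N_gt0 : (0 < N)%N.

Lemma empirical_eq1 (A : set T) : (forall j, A (zeta j)) ->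
  empirical R zeta A = 1%E.
Proof.
move=> Az; rewrite /empirical (eq_bigr (fun=> 1%E)) => [|j _]; last first.
  by rewrite diracE mem_set.
rewrite (_ : 1%E = (1:R)%:E)// sumEFin sumr_const card_ord -EFinM mulVf//.
by rewrite pnatr_eq0 -lt0n.
Qed.

Lemma empirical_eq0 (A : set T) : (forall j, ~ A (zeta j)) ->
  empirical R zeta A = 0%E.
Proof.
move=> Az; rewrite /empirical big1 ?mule0// => j _.
by rewrite diracE memNset.
Qed.

Definition empirical_probability : probability T R :=
  HB.pack (empirical R zeta)
    (Measure_isProbability.Build _ _ _ (empirical R zeta)
      (empirical_eq1 (A := setT) (fun=> I))).

Lemma integral_empirical (D : set T) (f : T -> \bar R) :
    (forall t : T, measurable [set t]) -> finite_set D ->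
    (forall j, D (zeta j)) -> (forall t, D t -> f t \is a fin_num) ->
  (\int[empirical R zeta]_(t in D) f t = (N%:R^-1)%:E * \sum_(j < N) f (zeta j))%E.
Proof.
move=> m1 finD Dzeta ffin; have mD := finite_measurable m1 finD.
rewrite integralE !ge0_integral_empirical//; try exact: finite_measurable_fun.
pose g j := fine (f (zeta j)).
have fE j : f (zeta j) = (g j)%:E by rewrite fineK// ffin.
under eq_bigr do rewrite funeposE fE -EFin_max.
under [X in (_ - _ * X)%E]eq_bigr do rewrite funenegE fE -EFinN -EFin_max.
under [in RHS]eq_bigr do rewrite fE.
rewrite !sumEFin -!EFinM -EFinB -mulrBr -sumrB; congr (_ * _)%:E.
by apply: eq_bigr => j _; case: (leP (g j) 0); case: (leP (- g j) 0); lra.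
Qed.

End EmpiricalFacts.

Lemma finite_binary_vectors (R : realType) m : finite_set (@binary_vectors R m).
Proof.
pose F (f : {ffun 'I_m -> bool}) : 'cV[R]_m := \col_t (f t)%:R.
apply: (@sub_finite_set _ _ (range F)); last exact: finite_image.
move=> v v01; exists [ffun t => v t 0 == 1] => //.
apply/matrixP => t j; rewrite ord1 mxE ffunE.
by case: (v01 t) => ->; rewrite ?eqxx// eq_sym oner_eq0.
Qed.

(** * Bounds for the ambiguity set *)

Section Ambiguity.
Context (R : realType) (m1 m2 N : nat).
Local Notation V := ('cV[R]_m1 * 'cV[R]_m2)%type.
Variables (xiT : 'cV[R]_m2) (theta p : R) (zeta : 'I_N -> V).
Local Notation Xi := (@binary_vectors R m1 `*` [set xiT]).
Hypotheses (N_gt0 : (0 < N)%N) (theta_ge0 : 0 <= theta) (p_gt0 : 0 < p).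
Hypothesis zeta_Xi : forall j, Xi (zeta j).
Local Notation K := ((Num.floor (theta `^ p))%:~R : R).

Lemma measurable_set1_support (v : V) : measurable [set v].
Proof. by apply: measurable_set1_pair; exact: measurable_set1_col. Qed.

Lemma finite_binary_support : finite_set Xi.
Proof. by apply: finite_setX => //; exact: finite_binary_vectors. Qed.

(** The empirical distribution of the pairs (xi j, zeta j) is a coupling. Its mass sits on these
    pairs, each at distance at most [theta], so its essential supremum is at most [theta]. *)
Lemma empirical_ambiguity (xi : 'I_N -> V) :
    (forall j, Xi (xi j)) -> (forall j, hamming (xi j).1 (zeta j).1 <= K) ->
  ambiguity_set Xi p theta zeta (empirical_probability R xi N_gt0).
Proof.
move=> Xi_xi xi_near; split; first exact: empirical_eq1.
pose w j := (xi j, zeta j).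
apply: (@le_trans _ _ (ess_sup (empirical_probability R w N_gt0)
    (fun w : V * V => (lp_dist p w.1 w.2)%:E))).
  apply: ereal_inf_lbound; exists (empirical_probability R w N_gt0) => //.
apply/ess_supP; exists (~` range w); split.
- apply: measurableC; apply: finite_measurable; last exact: finite_image.
  by move=> v; apply: measurable_set1_pair; exact: measurable_set1_support.
- by apply: empirical_eq0 => j; apply; exists j.
move=> v /= v_far [j _ vE]; apply: v_far; rewrite -vE lee_fin /=.
have [[xi1 xi2] [z1 z2]] := (Xi_xi j, zeta_Xi j).
rewrite lp_dist_hamming ?gt_eqF//; last by rewrite xi2 z2.
exact: hamming_powR_le.
Qed.

(** A nearly optimal coupling puts almost every pair within Hamming distance floor(theta^p), where
    [f] at the first point is at most [g] at the second. *)
Lemma le_integral_ambiguity (P : probability V R) (f g : V -> \bar R) :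
    ambiguity_set Xi p theta zeta P ->
    (forall v, Xi v -> f v \is a fin_num) -> (forall v, Xi v -> g v \is a fin_num) ->
    (forall u v, Xi u -> Xi v -> hamming u.1 v.1 <= K -> (f u <= g v)%E) ->
  (\int[P]_(v in Xi) f v <= (N%:R^-1)%:E * \sum_(j < N) g (zeta j))%E.
Proof.
move=> [PXi PW] ffin gfin fg.
have mXi : measurable Xi.
  by apply: finite_measurable finite_binary_support; exact: measurable_set1_support.
rewrite -(integral_empirical N_gt0 measurable_set1_support finite_binary_support)//.
(* the infimum over couplings need not be attained, but integrality of the
   Hamming distance leaves room for a strict bound *)
set B := (Num.floor (theta `^ p) + 1)%:~R `^ p^-1 : R.
have /ereal_inf_lt[_ [G Gc <-] GB] : (wasserstein_infty p P (empirical R zeta) < B%:E)%E.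
  by apply: le_lt_trans PW _; rewrite lte_fin lt_floor_powR.
apply: (@le_integral_coupling _ _ _ _ _ G _ [set w | lp_dist p w.1 w.2 < B]) => //.
- exact: measurable_set1_support.
- exact: finite_binary_support.
- by move=> A /Gc[].
- by move=> A /Gc[].
- by have := probability_setC P mXi; rewrite PXi subee.
- by apply: empirical_eq0 => j; apply.
- have := ess_sup_ge G (fun w : V * V => (lp_dist p w.1 w.2)%:E).
  by apply: filterS => w wG; rewrite /= -lte_fin (le_lt_trans wG).
move=> w w1 w2 /= wB; apply: fg => //.
case: (w1) (w2) => [w11 w12] [w21 w22].
rewrite hamming_le_floor//; apply: (powR_hamming_lt (p := p)) => //.
  have /andP[_ ltf] := floor_itv (theta `^ p).
  by rewrite (le_trans _ (ltW ltf))// powR_ge0.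
by move: wB; rewrite lp_dist_hamming ?gt_eqF// w12 w22.
Qed.

End Ambiguity.

(** * Combination of the upper and lower bounds *)

Theorem theorem5 (R : realType) (n1 n2 m1 m2 l N : nat)
    (n1_gt0 : (0 < n1)%N) (n2_gt0 : (0 < n2)%N) (m1_gt0 : (0 < m1)%N)
    (m2_gt0 : (0 < m2)%N) (l_gt0 : (0 < l)%N) (N_gt0 : (0 < N)%N)
    (X : set 'cV[R]_n1)
    (W : 'M[R]_(l, n2)) (Q : 'M[R]_(n2, m1)) (q : 'cV[R]_n2)
    (h : 'cV[R]_n1 -> 'cV[R]_l) (T : 'cV[R]_n1 -> 'M[R]_(l, m2))
    (h_affine : is_affine h) (T_affine : is_affine T)
    (xiT : 'cV[R]_m2)
    (Xi : set ('cV[R]_m1 * 'cV[R]_m2))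
    (XiE : Xi = @binary_vectors R m1 `*` [set xiT])
    (theta : R) (theta_ge0 : 0 <= theta)
    (zeta : 'I_N -> 'cV[R]_m1 * 'cV[R]_m2)
    (zeta_Xi : forall j, Xi (zeta j))
    (recourse_expensive : expensive_recourse W Q q X Xi)
    (integrality : forall (j : 'I_N) (kappa : nat),
       integral_polyhedron (budget_polyhedron W Q q (zeta j).1 kappa))
    (p : R) (p_ge1 : 1 <= p) (x : 'cV[R]_n1) (xX : X x) :
  worst_case_expectation Xi p theta zeta (recourse W Q q h T x) =
  ((N%:R^-1)%:E *
   \sum_(j < N)
     ereal_inf
       [set ((dotv (Q *m (zeta j).1 + q) s.1.1
             + (Num.floor (theta `^ p))%:~R * s.1.2
             + \sum_(t < m1) s.2 t 0)%R)%:E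
       | s in [set s : 'cV[R]_n2 * R * 'cV[R]_m1 |
           let y := s.1.1 in let lambda := s.1.2 in let sigma := s.2 in
           ([/\ 0 <= lambda,
               forall t, 0 <= sigma t 0,
               forall i, h x i 0 <= (T x *m xiT + W *m y) i 0,
               forall t, t \in coords0 (zeta j).1 ->
                 (Q^T *m y) t 0 <= lambda + sigma t 0 &
               forall t, t \in coords1 (zeta j).1 ->
                 - (Q^T *m y) t 0 <= lambda + sigma t 0])%R]])%E.

Proof.
have p_gt0 : 0 < p by lra.
(* The integrality hypothesis takes a natural budget; the floor is nonnegative, so its absolute
   value is the same number. *)
pose kappa := `|Num.floor (theta `^ p)|%N.
have kappaE : (Num.floor (theta `^ p))%:~R = kappa%:R :> R.
  by rewrite [RHS]pmulrn /kappa gez0_abs// floor_ge0 powR_ge0.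
pose V (v : 'cV[R]_m1 * 'cV[R]_m2) :=
  robust_value W Q q (h x) (T x *m xiT) kappa%:R v.1.
transitivity ((N%:R^-1)%:E * \sum_(j < N) V (zeta j))%E; last first.
  by rewrite /V -kappaE.
have zeta01 j : binary_vectors (zeta j).1 /\ (zeta j).2 = xiT.
  by have := zeta_Xi j; rewrite XiE => -[].
apply/eqP; rewrite eq_le; apply/andP; split.
  apply: ge_ereal_sup => _ [P Pamb <-].
  have [feas|infeas] := pselect (recourse_feasible W h T x xiT !=set0).
    rewrite XiE in Pamb *.
    apply: (le_integral_ambiguity N_gt0 theta_ge0 p_gt0 zeta01 Pamb).
    - move=> [v1 v2] [/= v01 ->]; apply: recourse_fin_num => //.
      by have [|pi] := recourse_expensive x (v1, xiT) xX; [rewrite XiE|exists pi].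
    - move=> [v1 v2] [/= v01 ->]; apply: robust_value_fin_num => //.
      by have [|pi] := recourse_expensive x (v1, xiT) xX; [rewrite XiE|exists pi].
    - move=> [u1 u2] [v1 v2] [/= u01 ->] [/= v01 _]; rewrite kappaE => uv.
      exact: recourse_le_robust_value.
  (* Without a feasible recourse decision every robust value is +oo; as N > 0, so is their
     average. *)
  rewrite [leRHS](_ : _ = +oo%E) ?leey//.
  under eq_bigr do rewrite /V robust_value_infeasible//.
  rewrite (bigD1 (Ordinal N_gt0))//= addye; last first.
    by rewrite gt_eqF// (lt_le_trans ltNy0)// sume_ge0.
  by rewrite gt0_muley// lte_fin invr_gt0 ltr0n.
(* Any choice of one point per ball yields an admissible distribution, hence a lower bound. *)
have lower (xi : 'I_N -> 'cV[R]_m1 * 'cV[R]_m2) : (forall j, Xi (xi j)) ->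
    (forall j, hamming (xi j).1 (zeta j).1 <= (Num.floor (theta `^ p))%:~R) ->
    (\int[empirical R xi]_(v in Xi) recourse W Q q h T x v <=
     worst_case_expectation Xi p theta zeta (recourse W Q q h T x))%E.
  move=> Xi_xi xi_near; apply: ereal_sup_ubound.
  exists (empirical_probability R xi N_gt0) => //.
  by rewrite XiE in zeta_Xi Xi_xi *; exact: empirical_ambiguity.
have finXi : finite_set Xi by rewrite XiE; exact: finite_binary_support.
have [feas|infeas] := pselect (recourse_feasible W h T x xiT !=set0).
  (* The worst point is picked in each ball independently of the others. *)
  have /choice[xi xiP] j : exists v, [/\ Xi v,
      hamming v.1 (zeta j).1 <= (Num.floor (theta `^ p))%:~R &
      (V (zeta j) <= recourse W Q q h T x v)%E].
    have [v [v01 vz Vv]] :=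
      robust_value_attained (zeta01 j).1 (integrality j kappa) feas.
    by exists (v, xiT); split; rewrite ?XiE ?kappaE.
  apply: le_trans (lower xi _ _); try by move=> j; case: (xiP j).
  rewrite (integral_empirical N_gt0 (@measurable_set1_support _ _ _) finXi).
  - apply: lee_wpmul2l; first by rewrite lee_fin invr_ge0.
    by apply: lee_sum => j _; case: (xiP j).
  - by move=> j; case: (xiP j).
  - rewrite XiE => -[v1 v2] [/= v01 ->]; apply: recourse_fin_num => //.
    by have [|pi] := recourse_expensive x (v1, xiT) xX; [rewrite XiE|exists pi].
have Z_oo v : Xi v -> recourse W Q q h T x v = +oo%E.
  by rewrite XiE; case: v => v1 v2 [/= _ ->]; exact: recourse_infeasible.
(* In the infeasible case the recourse function is +oo on the support, so the empirical distribution
   of [zeta] itself suffices. *)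
apply: le_trans (lower zeta zeta_Xi _); last first.
  by move=> j; rewrite hammingxx kappaE ler0n.
rewrite ge0_integral_empirical//.
- apply: lee_wpmul2l; first by rewrite lee_fin invr_ge0.
  by apply: lee_sum => j _; rewrite Z_oo// leey.
- exact: finite_measurable (@measurable_set1_support _ _ _) finXi.
- exact: finite_measurable_fun (@measurable_set1_support _ _ _) finXi.
- by move=> v /Z_oo ->.
Qed.
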